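(* Let $(M,L)$ be a Finsler spacetime of Berwald type whose set of admissible vectors is the whole slit tangent bundle, $\mathcal{A} = TM\setminus\{0\}$ (so $L$ is smooth and its $L$-metric $g^L$ is nondegenerate on all of $TM\setminus\{0\}$). Let $\Gamma^a{}_{bc}(x)$ be the coefficients of the affine connection on $M$ induced by $L$, and let $$R_{ab}(x) = \partial_m \Gamma^m{}_{ab} - \partial_b \Gamma^m{}_{am} + \Gamma^m{}_{ms} \Gamma^s{}_{ab} - \Gamma^m{}_{bs} \Gamma^s{}_{am}$$ be its Ricci tensor. Then $R_{ba}(x) = R_{ab}(x)$ for all $x\in M$.
   Context: Let $M$ be a smooth $n$-dimensional manifold and $TM$ its tangent bundle with induced local coordinates $(x^a,\dot x^a)$, where $\dot x=\dot x^a\partial_a\in T_xM$. Write $\partial_a=\partial/\partial x^a$ and $\dot\partial_a=\partial/\partial\dot x^a$. Smooth means $C^\infty$. Conic subbundle: a non-empty open submanifold $\mathcal{Q}\subset TM\setminus\{0\}$ such that $\pi(\mathcal{Q})=M$, where $\pi:TM\to M$ is the projection, and such that $(x,\dot x)\in\mathcal{Q}$ implies $(x,\lambda\dot x)\in\mathcal{Q}$ for all $\lambda>0$. Finsler spacetime: a pair $(M,L)$, where $L:\mathcal{A}\to\mathbb{R}$ (the Finsler Lagrangian) is a smooth function on a conic subbundle $\mathcal{A}\subset TM$ (the set of admissible vectors) such that: (i) $L(x,\lambda\dot x)=\lambda^2L(x,\dot x)$ for all $\lambda>0$; (ii) on $\mathcal{A}$ the $L$-metric $g^L_{ab}=\frac12\dot\partial_a\dot\partial_bL$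 is nondegenerate; (iii) there is a conic subset $\mathcal{T}\subset\mathcal{A}$ on which $L>0$ and $g^L$ has Lorentzian signature $(+,-,\dots,-)$, and $L$ can be continuously extended to the boundary $\partial\mathcal{T}$ by $L|_{\partial\mathcal{T}}=0$. (Equivalently, one may use the opposite sign of $L$ and signature $(-,+,\dots,+)$.) Geodesic spray coefficients on $\mathcal{A}$: $G^a=\frac14 (g^L)^{aq}(\dot x^m\partial_m\dot\partial_qL-\partial_qL)$. Berwald type: $(M,L)$ is of Berwald type (a Berwald spacetime) if $G^a(x,\dot x)=\frac12\Gamma^a{}_{bc}(x)\dot x^b\dot x^c$ with coefficients $\Gamma^a{}_{bc}(x)=\dot\partial_b\dot\partial_cG^a$ (symmetric in $b,c$) depending only on $x$. These are the coefficients of a torsion-free affine connection on $M$, the affine connection induced by $L$. They coincide with the Chern--Rund connection coefficients $\frac12 (g^L)^{aq}(\delta_bg^L_{cq}+\delta_cg^L_{bq}-\delta_qg^L_{bc})$, where $\delta_a=\partial_a-(\dot\partial_aG^b)\dot\partial_b$. *)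

(* Defs.v *)
(* Smooth manifolds modelled on 'rV[R]_n (R : realType), their tangent bundles,
   and Finsler spacetimes on them. *)
From HB Require Import structures.
From mathcomp Require Import all_boot all_order all_algebra.
From mathcomp Require Import all_classical all_reals topology normedtype derive.

Set Implicit Arguments.
Unset Strict Implicit.
Unset Printing Implicit Defensive.

Import Order.TTheory GRing.Theory Num.Theory.
Import numFieldNormedType.Exports.

Local Open Scope classical_set_scope.
Local Open Scope ring_scope.

(* C^k on U, by recursion on the directional derivatives; U is meant to be open
   and V finite-dimensional, in which case this is the usual notion. *)
Fixpoint continuously_differentiable (R : realType) (V W : normedModType R)
    (U : set V) (k : nat) (f : V -> W) : Prop :=
  if k is k'.+1 then
    (forall x, U x -> differentiable f x) /\
    (forall v, continuously_differentiable U k' (fun x => 'D_v f x))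
  else forall x, U x -> {for x, continuous f}.

Definition smooth (R : realType) (V W : normedModType R) (U : set V)
    (f : V -> W) : Prop :=
  forall k, continuously_differentiable U k f.

(* The values of chart_map outside chart_dom, and of chart_inv outside the
   image of chart_dom, are junk. *)
Record chart (R : realType) (n : nat) (M : topologicalType) := Chart {
  chart_dom : set M;
  chart_map :> M -> 'rV[R]_n;
  chart_inv : 'rV[R]_n -> M;
  chart_dom_open : open chart_dom;
  chart_img_open : open (chart_map @` chart_dom);
  chart_mapK : forall x, chart_dom x -> chart_inv (chart_map x) = x;
  chart_map_continuous :
    forall x, chart_dom x -> {for x, continuous chart_map};
  chart_inv_continuous :
    forall u, (chart_map @` chart_dom) u -> {for u, continuous chart_inv} }.

Definition chart_img (R : realType) (n : nat) (M : topologicalType)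
    (c : chart R n M) : set 'rV[R]_n :=
  c @` chart_dom c.

Definition transition (R : realType) (n : nat) (M : topologicalType)
    (c c' : chart R n M) : 'rV[R]_n -> 'rV[R]_n :=
  c' \o chart_inv c.

Definition smoothly_compatible (R : realType) (n : nat) (M : topologicalType)
    (c c' : chart R n M) : Prop :=
  smooth (c @` (chart_dom c `&` chart_dom c')) (transition c c') /\
  smooth (c' @` (chart_dom c' `&` chart_dom c)) (transition c' c).

Record manifold (R : realType) (n : nat) := Manifold {
  carrier :> topologicalType;
  manifold_hausdorff : hausdorff_space carrier;
  manifold_second_countable : @second_countable carrier;
  atlas : set (chart R n carrier);
  atlas_cover : forall x, exists2 c, atlas c & chart_dom c x;
  atlas_compatible : forall c c', atlas c -> atlas c' ->
    smoothly_compatible c c';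
  atlas_maximal : forall c, (forall c', atlas c' -> smoothly_compatible c c') ->
    atlas c }.

Definition chart_at (R : realType) (n : nat) (M : manifold R n) (x : M) :
    set (chart R n M) :=
  [set c | atlas c /\ chart_dom c x].

(* A tangent vector at x is the family of its components in all the charts
   around x, related by the Jacobians of the transition maps; components in the
   other charts are set to 0 so that equality of tangent vectors is Leibniz
   equality. *)
Record tangent_bundle (R : realType) (n : nat) (M : manifold R n) :=
  TangentVector {
  base : M;
  component : chart R n M -> 'rV[R]_n;
  component_out : forall c, ~ chart_at base c -> component c = 0;
  component_compat : forall c c', chart_at base c -> chart_at base c' ->
    component c' = 'd (transition c c') (c base) (component c) }.

HB.instance Definition _ (R : realType) (n : nat) (M : manifold R n) :=
  gen_eqMixin (tangent_bundle M).
HB.instance Definition _ (R : realType) (n : nat) (M : manifold R n) :=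
  gen_choiceMixin (tangent_bundle M).

(* The induced local coordinates (x^a, xdot^a). *)
Definition tangent_coord (R : realType) (n : nat) (M : manifold R n)
    (c : chart R n M) (X : tangent_bundle M) : 'rV[R]_n * 'rV[R]_n :=
  (c (base X), component X c).

(* Preimages of open sets of coordinates; they generate the topology in which
   every induced chart of the tangent bundle is a homeomorphism onto its
   image. *)
Definition tangent_subbase (R : realType) (n : nat) (M : manifold R n) :
    set (set (tangent_bundle M)) :=
  [set S | exists c (W : set ('rV[R]_n * 'rV[R]_n)), [/\ atlas c, open W &
     S = [set X | chart_dom c (base X) /\ W (tangent_coord c X)]]].

HB.instance Definition _ (R : realType) (n : nat) (M : manifold R n) :=
  isSubBaseTopological.Build (tangent_bundle M) (@tangent_subbase R n M) id.

Section TangentVectors.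
Context (R : realType) (n : nat) (M : manifold R n).

Lemma tangent_scale_out (l : R) (X : tangent_bundle M) (c : chart R n M) :
  ~ chart_at (base X) c -> l *: component X c = 0.
Proof. by move=> /component_out ->; rewrite scaler0. Qed.

Lemma tangent_scale_compat (l : R) (X : tangent_bundle M) (c c' : chart R n M) :
  chart_at (base X) c -> chart_at (base X) c' ->
  l *: component X c' =
  'd (transition c c') (c (base X)) (l *: component X c).
Proof. by move=> hc hc'; rewrite linearZ /= -component_compat. Qed.

Definition tangent_scale (l : R) (X : tangent_bundle M) : tangent_bundle M :=
  TangentVector (@tangent_scale_out l X) (@tangent_scale_compat l X).

(* Components in the chart c' of the vector with coordinates z in the chart c. *)
Definition component_of_coord (c : chart R n M) (z : 'rV[R]_n * 'rV[R]_n)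
    (c' : chart R n M) : 'rV[R]_n :=
  if `[< [/\ atlas c, chart_img c z.1 & chart_at (chart_inv c z.1) c'] >]
  then 'd (transition c c') (z.1) (z.2) else 0.

Lemma component_of_coord_out c z c' :
  ~ chart_at (chart_inv c z.1) c' -> component_of_coord c z c' = 0.
Proof. by move=> h; rewrite /component_of_coord asboolF // => -[]. Qed.

Lemma differentiable_transition (x : M) (c c' : chart R n M) :
  chart_at x c -> chart_at x c' -> differentiable (transition c c') (c x).
Proof.
move=> [Ac cx] [Ac' c'x]; have [+ _] := atlas_compatible Ac Ac'.
by move=> /(_ 1%N)[+ _]; apply; exists x.
Qed.

Lemma diff_transition_comp (x : M) (c c' c'' : chart R n M) (v : 'rV[R]_n) :
  chart_at x c -> chart_at x c' -> chart_at x c'' ->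
  'd (transition c c'') (c x) v =
  'd (transition c' c'') (c' x) ('d (transition c c') (c x) v).
Proof.
move=> hc hc' hc''; have [Ac cx] := hc; have [Ac' c'x] := hc'.
have E : transition c c' (c x) = c' x by rewrite /transition /= chart_mapK.
have D : differentiable (transition c' c'') (transition c c' (c x)).
  by rewrite E; exact: differentiable_transition.
have D' := differentiable_transition hc hc'.
have D'' := differentiable_comp D' D.
have DE := diff_comp D' D.
have DEv := f_equal (fun f : 'rV[R]_n -> 'rV[R]_n => f v) DE.
rewrite [in RHS]E in DEv; apply: eq_trans DEv.
have D1 := differentiable_transition hc hc''.
apply: eq_trans (esym (deriveE v D1)) (eq_trans _ (deriveE v D'')).
apply: near_eq_derive.
have : \forall u \near c x, chart_dom c' (chart_inv c u).
  apply: chart_inv_continuous; first by exists x.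
  by rewrite chart_mapK //; exact: open_nbhs_nbhs (conj (chart_dom_open c') c'x).
by apply: filterS => u hu; rewrite /transition /= chart_mapK.
Qed.

Lemma diff_transition_id (x : M) (c : chart R n M) (v : 'rV[R]_n) :
  chart_at x c -> 'd (transition c c) (c x) v = v.
Proof.
move=> hc; have [Ac cx] := hc.
rewrite -deriveE; last exact: differentiable_transition.
rewrite (@near_eq_derive _ _ _ _ id) ?derive_id //.
have : nbhs (c x) (c @` chart_dom c).
  by apply: open_nbhs_nbhs; split; [exact: chart_img_open|exists x].
by apply: filterS => _ [y cy <-]; rewrite /transition /= chart_mapK.
Qed.

Lemma component_of_coord_compat c z c' c'' :
  chart_at (chart_inv c z.1) c' -> chart_at (chart_inv c z.1) c'' ->
  component_of_coord c z c'' =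
  'd (transition c' c'') (c' (chart_inv c z.1)) (component_of_coord c z c').
Proof.
move=> hc' hc''; rewrite /component_of_coord.
have [[Ac Iz]|h] := asboolP (atlas c /\ chart_img c z.1); last first.
  by rewrite !asboolF ?linear0 // => -[*]; apply: h.
rewrite !asboolT //; case: Iz hc' hc'' => x cx <-; rewrite chart_mapK // => *.
by apply: diff_transition_comp.
Qed.

(* The inverse of tangent_coord c; its values are junk when c is not in the atlas
   or z.1 is not in the image of c. *)
Definition of_tangent_coord (c : chart R n M) (z : 'rV[R]_n * 'rV[R]_n) :
    tangent_bundle M :=
  TangentVector (@component_of_coord_out c z) (@component_of_coord_compat c z).

Lemma of_tangent_coordK (c : chart R n M) (z : 'rV[R]_n * 'rV[R]_n) :
  atlas c -> chart_img c z.1 -> tangent_coord c (of_tangent_coord c z) = z.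
Proof.
case: z => _ v /= Ac [x cx <-]; rewrite /tangent_coord /= chart_mapK //.
rewrite /component_of_coord /= chart_mapK // asboolT ?diff_transition_id //.
by split=> //; exists x.
Qed.

Lemma tangent_coordK (c : chart R n M) (X : tangent_bundle M) :
  chart_at (base X) c -> of_tangent_coord c (tangent_coord c X) = X.
Proof.
move=> hc; have [Ac cx] := hc.
case: X hc cx => x f fout fcompat /= hc cx.
have B : chart_inv c (c x) = x by rewrite chart_mapK.
have C : component_of_coord c (c x, f c) = f.
  apply/funext => c'; rewrite /component_of_coord /= B.
  case: asboolP => [[_ _ hc']|h]; first by rewrite -fcompat.
  by rewrite fout // => hc'; apply: h; split=> //; exists x.
rewrite /of_tangent_coord /tangent_coord /=.
move: (@component_of_coord_out _ _) (@component_of_coord_compat _ _).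
rewrite /= C B => fout' fcompat'.
by congr TangentVector; exact: Prop_irrelevance.
Qed.

End TangentVectors.

Definition coord_set (R : realType) (n : nat) (M : manifold R n)
    (A : set (tangent_bundle M)) (c : chart R n M) :
    set ('rV[R]_n * 'rV[R]_n) :=
  [set z | chart_img c z.1 /\ A (of_tangent_coord c z)].

Definition coord_fun (R : realType) (n : nat) (M : manifold R n)
    (L : tangent_bundle M -> R) (c : chart R n M) (z : 'rV[R]_n * 'rV[R]_n) : R :=
  L (of_tangent_coord c z).

Definition slit_tangent_bundle (R : realType) (n : nat) (M : manifold R n) :
    set (tangent_bundle M) :=
  [set X | ~ (forall c, component X c = 0)].

Definition conic (R : realType) (n : nat) (M : manifold R n)
    (A : set (tangent_bundle M)) : Prop :=
  forall (X : tangent_bundle M) (l : R), 0 < l -> A X -> A (tangent_scale l X).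

Definition conic_subbundle (R : realType) (n : nat) (M : manifold R n)
    (A : set (tangent_bundle M)) : Prop :=
  [/\ A !=set0, open A, A `<=` @slit_tangent_bundle R n M,
      @base R n M @` A = setT & conic A].

Definition position_derive (R : realType) (n : nat) (a : 'I_n)
    (f : 'rV[R]_n * 'rV[R]_n -> R) (z : 'rV[R]_n * 'rV[R]_n) : R :=
  'D_(delta_mx 0 a, 0) f z.

Definition velocity_derive (R : realType) (n : nat) (a : 'I_n)
    (f : 'rV[R]_n * 'rV[R]_n -> R) (z : 'rV[R]_n * 'rV[R]_n) : R :=
  'D_(0, delta_mx 0 a) f z.

(* In the next two definitions, l is the expression of L in local coordinates. *)
Definition lagrange_metric (R : realType) (n : nat)
    (l : 'rV[R]_n * 'rV[R]_n -> R) (z : 'rV[R]_n * 'rV[R]_n) : 'M[R]_n :=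
  \matrix_(a, b) (2^-1 * velocity_derive a (velocity_derive b l) z).

Definition spray (R : realType) (n : nat) (l : 'rV[R]_n * 'rV[R]_n -> R)
    (a : 'I_n) (z : 'rV[R]_n * 'rV[R]_n) : R :=
  4^-1 * \sum_q invmx (lagrange_metric l z) a q *
    (\sum_m z.2 0 m * position_derive m (velocity_derive q l) z
     - position_derive q l z).

(* Signature (+,-,...,-): congruent to diag(1,-1,...,-1). *)
Definition lorentzian (R : realType) (n : nat) (g : 'M[R]_n) : Prop :=
  exists2 P : 'M[R]_n, P \in unitmx &
    P *m g *m P^T = diag_mx (\row_i (if val i == 0%N then 1 else -1)).

Definition boundary (T : topologicalType) (S : set T) : set T :=
  closure S `\` interior S.

(* Only the restriction of L to A matters. *)
Record finsler_spacetime (R : realType) (n : nat) (M : manifold R n)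
    (A : set (tangent_bundle M)) (L : tangent_bundle M -> R) : Prop := {
  finsler_admissible : conic_subbundle A;
  finsler_smooth : forall c, atlas c -> smooth (coord_set A c) (coord_fun L c);
  finsler_homogeneous : forall X (l : R), A X -> 0 < l ->
    L (tangent_scale l X) = l ^+ 2 * L X;
  finsler_nondegenerate : forall c z, atlas c -> coord_set A c z ->
    lagrange_metric (coord_fun L c) z \in unitmx;
  finsler_timelike : exists T : set (tangent_bundle M),
    [/\ T !=set0, T `<=` A, conic T, forall X, T X -> 0 < L X &
        forall c z, atlas c -> coord_set T c z ->
          lorentzian (lagrange_metric (coord_fun L c) z)] /\
    exists F : tangent_bundle M -> R,
      [/\ {within closure T, continuous F}, forall X, T X -> F X = L X &
          forall X, boundary T X -> F X = 0] }.

(* Gamma c u a b d is the coefficient Gamma^a_{bd} in the chart c at the point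
   with coordinates u. *)
Definition induced_connection (R : realType) (n : nat) (M : manifold R n)
    (A : set (tangent_bundle M)) (L : tangent_bundle M -> R)
    (Gamma : chart R n M -> 'rV[R]_n -> 'I_n -> 'I_n -> 'I_n -> R) : Prop :=
  forall c z, atlas c -> coord_set A c z ->
    let G := spray (coord_fun L c) in
    (forall a, G a z =
       2^-1 * \sum_b \sum_d Gamma c z.1 a b d * z.2 0 b * z.2 0 d) /\
    (forall a b d,
       Gamma c z.1 a b d = velocity_derive b (velocity_derive d (G a)) z).

Definition berwald (R : realType) (n : nat) (M : manifold R n)
    (A : set (tangent_bundle M)) (L : tangent_bundle M -> R) : Prop :=
  exists Gamma, induced_connection A L Gamma.

(* The components R_ab at u, from coefficients Gamma u m a b = Gamma^m_{ab}(u). *)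
Definition ricci (R : realType) (n : nat)
    (Gamma : 'rV[R]_n -> 'I_n -> 'I_n -> 'I_n -> R) (a b : 'I_n)
    (u : 'rV[R]_n) : R :=
  \sum_m 'D_(delta_mx 0 m) (fun y => Gamma y m a b) u
  - \sum_m 'D_(delta_mx 0 b) (fun y => Gamma y m a m) u
  + \sum_m \sum_s Gamma u m m s * Gamma u s a b
  - \sum_m \sum_s Gamma u m b s * Gamma u s a m.

(* Main.v *)
(* In a chart, write G^a for the spray, N^a_q = dG^a/dxdot^q, and D for the
   determinant of the L-metric. Euler's identity for L turns the definition of
   the spray into dL/dx^q = N^a_q dL/dxdot^a. Since Gamma^a_{bq} = dN^a_q/dxdot^b
   depends on x only, two further differentiations in xdot and Jacobi's formula give
     dD/dx^q - N^a_q dD/dxdot^a = 2 Gamma^a_{aq} D.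
   For fixed x, D is homogeneous of degree 0 in xdot on the whole punctured
   fibre, so it attains a maximum there (on the compact unit sphere) and all
   dD/dxdot^a vanish at some xdot. Differentiating the displayed identity once
   more at that point, the symmetry of the second derivatives of D and D <> 0
   force the 1-form Gamma^a_{aq} dx^q to be closed, which is the symmetry of the
   Ricci tensor. *)
Require Import Defs.
From HB Require Import structures.
From mathcomp Require Import all_boot all_order all_algebra.
From mathcomp Require Import all_classical all_reals topology normedtype derive.
From mathcomp Require Import landau ring lra.

Set Implicit Arguments.
Unset Strict Implicit.
Unset Printing Implicit Defensive.

Import Order.TTheory GRing.Theory Num.Theory.
Import numFieldNormedType.Exports.

Local Open Scope classical_set_scope.
Local Open Scope ring_scope.

(** * Smooth functions *)

(** The first-order expansion of [f] at [x] is also one of [g], so [diff_unique] identifies ['d g x]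
    with ['d f x], whose continuity is known. *)
Lemma near_eq_differentiable (R : realType) (V W : normedModType R)
    (f g : V -> W) (x : V) :
  {near x, f =1 g} -> differentiable f x -> differentiable g x.
Proof.
move=> fg df; have /diff_locallyP[dfc /eqaddoP dfo] := df.
have gE : g \o shift x = cst (g x) + 'd f x +o_ 0 id.
  apply/eqaddoP => e e0; have := dfo e e0; apply: filter_app.
  have : \forall y \near 0, f (y + x) = g (y + x).
    have := fg; rewrite -[X in X -> _]/(\near x, [set z | f z = g z] x).
    by rewrite (near_shift 0) subr0.
  apply: filterS => y /= fgy.
  by rewrite !fctE /= fgy (nbhs_singleton fg).
by apply/diff_locallyP; rewrite (diff_unique dfc gE).
Qed.

Section smooth_algebra.
Context (R : realType) (V : normedModType R) (U : set V).
Hypothesis openU : open U.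

Lemma open_near (x : V) : U x -> \forall y \near x, U y.
Proof. by move=> Ux; exact: open_nbhs_nbhs (conj openU Ux). Qed.

(** Openness of [U] turns agreement on [U] into agreement near each of its points, so directional
    derivatives agree on [U] as well. The closure properties below rest on this: the rules of
    calculus compute ['D_v] only on [U]. *)
Lemma continuously_differentiable_ext (k : nat) (f g : V -> R) :
  (forall x, U x -> f x = g x) -> continuously_differentiable U k f ->
  continuously_differentiable U k g.
Proof.
have near_fg (f' g' : V -> R) x :
    (forall x, U x -> f' x = g' x) -> U x -> {near x, f' =1 g'}.
  by move=> fg Ux; apply: filterS (open_near Ux) => y /fg.
elim: k f g => [|k IH] f g fg /=.
  move=> cf x Ux; have := cf x Ux.
  rewrite /prop_for /continuous_at (fg x Ux) => cfx.
  by apply: cvg_trans cfx; apply: near_eq_cvg; apply: near_fg Ux => y /fg.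
move=> [df Df]; split.
  by move=> x Ux; apply: near_eq_differentiable (df x Ux); exact: near_fg.
move=> v; apply: IH (Df v) => x Ux.
by apply: near_eq_derive; exact: near_fg.
Qed.

Lemma continuously_differentiableW (k : nat) (f : V -> R) :
  continuously_differentiable U k.+1 f -> continuously_differentiable U k f.
Proof.
elim: k f => [|k IH] f [df Df].
  by move=> x Ux; apply: differentiable_continuous; exact: df.
by split=> // v; exact: IH.
Qed.

Lemma continuously_differentiable_cst (k : nat) (c : R) :
  continuously_differentiable U k (fun _ : V => c).
Proof.
elim: k c => [|k IH] c; first by move=> x _; exact: cst_continuous.
split=> [x _|v]; first exact: differentiable_cst.
by apply: continuously_differentiable_ext (IH 0) => x _; rewrite derive_cst.
Qed.

Lemma continuously_differentiableD (k : nat) (f g : V -> R) :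
  continuously_differentiable U k f -> continuously_differentiable U k g ->
  continuously_differentiable U k (fun x => f x + g x).
Proof.
elim: k f g => [|k IH] f g.
  by move=> cf cg x Ux; exact: continuousD (cf x Ux) (cg x Ux).
move=> [df Df] [dg Dg]; split=> [x Ux|v].
  exact: differentiableD (df x Ux) (dg x Ux).
apply: continuously_differentiable_ext (IH _ _ (Df v) (Dg v)) => x Ux; apply/esym.
exact: deriveD (diff_derivable (df x Ux)) (diff_derivable (dg x Ux)).
Qed.

Lemma continuously_differentiableM (k : nat) (f g : V -> R) :
  continuously_differentiable U k f -> continuously_differentiable U k g ->
  continuously_differentiable U k (fun x => f x * g x).
Proof.
elim: k f g => [|k IH] f g.
  by move=> cf cg x Ux; exact: continuousM (cf x Ux) (cg x Ux).
move=> cf cg; have [df Df] := cf; have [dg Dg] := cg; split=> [x Ux|v].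
  exact: differentiableM (df x Ux) (dg x Ux).
(* Leibniz's rule pairs a derivative with an underived factor, so [f] and [g] themselves are also
   needed at order [k]. *)
have cf' := continuously_differentiableW cf.
have cg' := continuously_differentiableW cg.
apply: continuously_differentiable_ext
  (continuously_differentiableD (IH _ _ cf' (Dg v)) (IH _ _ cg' (Df v))) => x Ux; apply/esym.
exact: deriveM (diff_derivable (df x Ux)) (diff_derivable (dg x Ux)).
Qed.

Lemma continuously_differentiableV (k : nat) (f : V -> R) :
  (forall x, U x -> f x != 0) -> continuously_differentiable U k f ->
  continuously_differentiable U k (fun x => (f x)^-1).
Proof.
move=> f0; elim: k => [|k IH].
  by move=> cf x Ux; exact: continuousV (f0 x Ux) (cf x Ux).
move=> cf; have [df Df] := cf; split=> [x Ux|v].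
  exact: differentiableV (df x Ux) (f0 x Ux).
have {}IH := IH (continuously_differentiableW cf).
(* The derivative is written as [-1 * (f^-1 * f^-1 * 'D_v f)], a product of functions already known
   to be of class [k]. *)
apply: continuously_differentiable_ext
  (continuously_differentiableM (continuously_differentiable_cst k (-1))
    (continuously_differentiableM (continuously_differentiableM IH IH) (Df v))) => x Ux; apply/esym.
rewrite [LHS](deriveV (f0 x Ux) (diff_derivable (df x Ux))).
by rewrite -[_ *: _]/(_ * _) mulN1r mulNr expr2 invfM.
Qed.

Lemma smooth_ext (f g : V -> R) :
  (forall x, U x -> f x = g x) -> smooth U f -> smooth U g.
Proof. by move=> fg sf k; exact: continuously_differentiable_ext (sf k). Qed.

Lemma smooth_cst (c : R) : smooth U (fun _ : V => c).
Proof. by move=> k; exact: continuously_differentiable_cst. Qed.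

Lemma smoothD (f g : V -> R) :
  smooth U f -> smooth U g -> smooth U (fun x => f x + g x).
Proof. by move=> sf sg k; exact: continuously_differentiableD. Qed.

Lemma smoothM (f g : V -> R) :
  smooth U f -> smooth U g -> smooth U (fun x => f x * g x).
Proof. by move=> sf sg k; exact: continuously_differentiableM. Qed.

Lemma smoothN (f : V -> R) : smooth U f -> smooth U (fun x => - f x).
Proof.
move=> sf; apply: smooth_ext (smoothM (smooth_cst (-1)) sf) => x _.
by rewrite mulN1r.
Qed.

Lemma smoothB (f g : V -> R) :
  smooth U f -> smooth U g -> smooth U (fun x => f x - g x).
Proof. by move=> sf sg; exact: smoothD sf (smoothN sg). Qed.

Lemma smoothV (f : V -> R) :
  (forall x, U x -> f x != 0) -> smooth U f -> smooth U (fun x => (f x)^-1).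
Proof. by move=> f0 sf k; exact: continuously_differentiableV. Qed.

Lemma smooth_sum (I : Type) (r : seq I) (P : pred I) (f : I -> V -> R) :
  (forall i, P i -> smooth U (f i)) -> smooth U (fun x => \sum_(i <- r | P i) f i x).
Proof.
move=> sf; elim: r => [|i r IH].
  by apply: smooth_ext (smooth_cst 0) => x _; rewrite big_nil.
have [Pi|Pi] := boolP (P i).
  by apply: smooth_ext (smoothD (sf i Pi) IH) => x _; rewrite big_cons Pi.
by apply: smooth_ext IH => x _; rewrite big_cons (negbTE Pi).
Qed.

Lemma smooth_prod (I : Type) (r : seq I) (P : pred I) (f : I -> V -> R) :
  (forall i, P i -> smooth U (f i)) -> smooth U (fun x => \prod_(i <- r | P i) f i x).
Proof.
move=> sf; elim: r => [|i r IH].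
  by apply: smooth_ext (smooth_cst 1) => x _; rewrite big_nil.
have [Pi|Pi] := boolP (P i).
  by apply: smooth_ext (smoothM (sf i Pi) IH) => x _; rewrite big_cons Pi.
by apply: smooth_ext IH => x _; rewrite big_cons (negbTE Pi).
Qed.

Lemma smooth_linear (f : {linear V -> R}) : continuous f -> smooth U f.
Proof.
move=> cf [|k]; first by move=> x _; exact: cf.
split=> [x _|v]; first exact: linear_differentiable.
apply: continuously_differentiable_ext
  (continuously_differentiable_cst k (f v)) => x _.
by rewrite deriveE ?diff_lin //; exact: linear_differentiable.
Qed.

Lemma smooth_derive (v : V) (f : V -> R) : smooth U f -> smooth U ('D_v f).
Proof. by move=> sf k; have [_] := sf k.+1; exact. Qed.

Lemma smooth_differentiable (f : V -> R) (x : V) :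
  smooth U f -> U x -> differentiable f x.
Proof. by move=> /(_ 1%N)[+ _]; exact. Qed.

Lemma smooth_derivable (f : V -> R) (x v : V) :
  smooth U f -> U x -> derivable f x v.
Proof. by move=> sf Ux; exact/diff_derivable/smooth_differentiable. Qed.

Lemma smooth_determinant (n : nat) (A : V -> 'M[R]_n) :
  (forall i j, smooth U (fun x => A x i j)) -> smooth U (fun x => \det (A x)).
Proof.
move=> sA; apply: smooth_sum => s _; apply: smoothM; first exact: smooth_cst.
exact: smooth_prod.
Qed.

(** Cramer's rule: the entries of the inverse are cofactors over the determinant, and cofactors are
    signed determinants of minors. *)
Lemma smooth_invmx (n : nat) (A : V -> 'M[R]_n) (i j : 'I_n) :
  (forall i j, smooth U (fun x => A x i j)) ->
  (forall x, U x -> A x \in unitmx) -> smooth U (fun x => invmx (A x) i j).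
Proof.
move=> sA uA.
have sadj : smooth U (fun x => (\adj (A x)) i j).
  apply: (@smooth_ext (fun x => cofactor (A x) j i)) => [x _|]; first by rewrite mxE.
  apply: smoothM; first exact: smooth_cst.
  apply: smooth_determinant => k l.
  by apply: smooth_ext (sA (lift j k) (lift i l)) => x _; rewrite !mxE.
have sdet : smooth U (fun x => (\det (A x))^-1).
  apply: smoothV; last exact: smooth_determinant.
  by move=> x Ux; rewrite -unitfE -unitmxE uA.
apply: smooth_ext (smoothM sdet sadj) => x Ux.
by rewrite /invmx uA // !mxE.
Qed.

Lemma derive_smoothD (f g : V -> R) (x v : V) :
  smooth U f -> smooth U g -> U x ->
  'D_v (fun x => f x + g x) x = 'D_v f x + 'D_v g x.
Proof. by move=> sf sg Ux; exact: deriveD (smooth_derivable sf Ux) (smooth_derivable sg Ux). Qed.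

Lemma derive_smoothM (f g : V -> R) (x v : V) :
  smooth U f -> smooth U g -> U x ->
  'D_v (fun x => f x * g x) x = 'D_v f x * g x + f x * 'D_v g x.
Proof.
move=> sf sg Ux.
rewrite [LHS](deriveM (smooth_derivable sf Ux) (smooth_derivable sg Ux)).
by rewrite addrC mulrC.
Qed.

Lemma derive_smooth_sum (I : finType) (f : I -> V -> R) (x v : V) :
  (forall i, smooth U (f i)) -> U x ->
  'D_v (fun x => \sum_i f i x) x = \sum_i 'D_v (f i) x.
Proof.
move=> sf Ux; elim: (index_enum I) => [|i r IH].
  rewrite big_nil (_ : (fun _ => _) = fun=> 0) ?derive_cst //.
  by apply/funext => y; rewrite big_nil.
rewrite big_cons -IH -derive_smoothD //; last exact: smooth_sum.
by congr ('D_v _ x); apply/funext => y; rewrite big_cons.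
Qed.

Lemma derive_eq_on (f g : V -> R) (x v : V) :
  (forall y, U y -> f y = g y) -> U x -> 'D_v f x = 'D_v g x.
Proof.
by move=> fg Ux; apply: near_eq_derive; apply: filterS (open_near Ux) => y /fg.
Qed.

End smooth_algebra.

(** * Symmetry of second derivatives *)

(** The chain rule along an affine line; it makes the one-variable mean value and extremum theorems
    available for directional derivatives. *)
Lemma is_derive_line (R : realType) (V : normedModType R) (f : V -> R)
    (x u : V) (s : R) :
  differentiable f (s *: u + x) ->
  is_derive s 1 (fun t => f (t *: u + x)) ('D_u f (s *: u + x)).
Proof.
move=> df; pose g (t : R) : V := t *: u + x.
have dg : is_diff (s : R^o) (g : R^o -> V) ( *:%R^~ u).
  have : is_diff (s : R^o) (( *:%R^~ u : R^o -> V) + cst x)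
      (( *:%R^~ u : R^o -> V) + (0 : R^o -> V)).
    exact: is_diffD.
  by rewrite addr0.
have dF : is_diff (s : R^o) (f \o g : R^o -> R) ('d f (g s) \o *:%R^~ u).
  by apply: is_diff_comp; exact: DiffDef.
apply: DeriveDef; first by apply: diff_derivable; case: dF.
rewrite [LHS]deriveE; last by case: dF.
by rewrite (diff_val (f := f \o g)) /= scale1r deriveE.
Qed.

(** The mean value theorem is applied to the mixed second difference along [u], then along [v];
    continuity of the mixed derivative keeps its value at the intermediate point [p] close to that
    at [x]. *)
Lemma second_difference (R : realType) (V : normedModType R) (U : set V)
    (f : V -> R) (x u v : V) (e : R) :
  open U -> smooth U f -> U x -> 0 < e ->
  exists2 d, 0 < d & forall h, 0 < h -> h < d -> exists2 p,
    `|'D_v ('D_u f) p - 'D_v ('D_u f) x| < e &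
    f (h *: u + h *: v + x) - f (h *: u + x) - f (h *: v + x) + f x =
      h * h * 'D_v ('D_u f) p.
Proof.
move=> openU sf Ux e0.
have cg : {for x, continuous ('D_v ('D_u f))}.
  by apply: differentiable_continuous; apply: (@smooth_differentiable _ _ U) => //;
    do 2 apply: smooth_derive.
have /nbhs_ballP[r /= r0 rW] : nbhs x (U `&` [set p | `|'D_v ('D_u f) x - 'D_v ('D_u f) p| < e]).
  apply: filterI; first exact: open_near.
  by move/cvgrPdist_lt : cg; exact.
have m0 : 0 < `|u| + `|v| + 1 by rewrite ltr_wpDl ?addr_ge0.
(* With this bound on [h] the whole parallelogram spanned at [x] by [h *: u] and [h *: v] lies in
   the ball of radius [r]; the [1] keeps the denominator positive when [u = v = 0]. *)
exists (r / (`|u| + `|v| + 1)); first by rewrite divr_gt0.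
move=> h h0 hd.
have near s t : 0 <= s <= h -> 0 <= t <= h ->
    U (s *: u + t *: v + x) /\ `|'D_v ('D_u f) x - 'D_v ('D_u f) (s *: u + t *: v + x)| < e.
  move=> /andP[s0 sh] /andP[t0 th]; apply: (rW (s *: u + t *: v + x)).
  rewrite -ball_normE /= opprD addrC addrNK normrN.
  rewrite (le_lt_trans (ler_normD _ _))// !normrZ !ger0_norm//.
  rewrite ltr_pdivlMr // in hd; apply: le_lt_trans hd.
  rewrite !mulrDr mulr1 -[leLHS]addr0; apply: lerD; last exact: ltW.
  by apply: lerD; apply: ler_wpM2r.
(* The second difference is [phi h - phi 0]. *)
pose phi s := f (s *: u + (h *: v + x)) - f (s *: u + x).
pose dphi s := 'D_u f (s *: u + (h *: v + x)) - 'D_u f (s *: u + x).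
have Us s : 0 <= s <= h -> U (s *: u + x).
  by move=> sh; have [] := near s 0 sh; rewrite ?lexx ?ltW// scale0r addr0.
have Ush s : 0 <= s <= h -> U (s *: u + (h *: v + x)).
  by move=> sh; have [] := near s h sh; rewrite ?lexx ?ltW// addrA.
have dphiP s : 0 <= s <= h -> is_derive s 1 phi (dphi s).
  move=> sh; apply: is_deriveB; apply: is_derive_line.
    by apply: smooth_differentiable sf _; exact: Ush.
  by apply: smooth_differentiable sf _; exact: Us.
have itvW (s : R) : s \in `]0, h[ -> 0 <= s <= h.
  by rewrite in_itv /= => /andP[? ?]; rewrite !ltW.
have cphi : {within `[0, h], continuous phi}.
  apply: derivable_within_continuous => s; rewrite in_itv /= => sh.
  by case: (dphiP s sh).
have [xi xih phiE] := MVT h0 (fun s sh => dphiP s (itvW s sh)) cphi.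
(* The derivative of [phi] at [xi] is in turn the increment [psi h - psi 0], ready for the second
   mean value theorem. *)
pose psi t := 'D_u f (t *: v + (xi *: u + x)).
have Uxi t : 0 <= t <= h -> U (t *: v + (xi *: u + x)).
  by move=> th; have [] := near xi t (itvW _ xih) th; rewrite addrCA addrA.
pose dpsi t := 'D_v ('D_u f) (t *: v + (xi *: u + x)).
have dpsiP t : 0 <= t <= h ->
    is_derive t 1 psi (dpsi t).
  move=> th; apply: is_derive_line; apply: (@smooth_differentiable _ _ U).
    exact: smooth_derive.
  exact: Uxi.
have cpsi : {within `[0, h], continuous psi}.
  apply: derivable_within_continuous => s; rewrite in_itv /= => sh.
  by case: (dpsiP s sh).
have [eta etah psiE] := MVT h0 (fun t th => dpsiP t (itvW t th)) cpsi.
exists (eta *: v + (xi *: u + x)).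
  have [_] := near xi eta (itvW _ xih) (itvW _ etah).
  have -> : xi *: u + eta *: v + x = eta *: v + (xi *: u + x).
    by rewrite addrCA addrA.
  by move=> close; rewrite distrC; exact: close.
have dphi_psi : dphi xi = psi h - psi 0.
  by rewrite /dphi /psi scale0r add0r addrCA.
transitivity (phi h - phi 0).
  rewrite /phi scale0r !add0r -(addrA (h *: u)).
  by rewrite opprB [RHS]addrA [RHS]addrAC.
by rewrite phiE dphi_psi psiE subr0 /dpsi mulrC mulrA mulrAC.
Qed.

(** The second difference is symmetric in [u] and [v], so for one common small [h] the two mixed
    derivatives take equal values at intermediate points [p] and [q]. Each value is within [e / 2]
    of the one at [x], and [e] is arbitrary. *)
Lemma derive_comm (R : realType) (V : normedModType R) (U : set V)
    (f : V -> R) (x u v : V) :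
  open U -> smooth U f -> U x -> 'D_u ('D_v f) x = 'D_v ('D_u f) x.
Proof.
move=> openU sf Ux; apply/eqP; rewrite -subr_eq0 -normr_le0.
apply/ler_addgt0Pr => e e0; rewrite add0r.
have e20 : 0 < e / 2 by rewrite divr_gt0.
have [d1 d10 H1] := second_difference u v openU sf Ux e20.
have [d2 d20 H2] := second_difference v u openU sf Ux e20.
pose h := Num.min d1 d2 / 2.
have m0 : 0 < Num.min d1 d2 by rewrite lt_min d10.
have h0 : 0 < h by rewrite divr_gt0.
have /andP[hd1 hd2] : (h < d1) && (h < d2).
  by rewrite -lt_min ltr_pdivrMr // ltr_pMr // ltr1n.
have [p pe pE] := H1 h h0 hd1.
have [q qe qE] := H2 h h0 hd2.
have pq : 'D_v ('D_u f) p = 'D_u ('D_v f) q.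
  apply: (@mulfI _ (h * h)); first by rewrite mulf_neq0 ?gt_eqF.
  apply: etrans (esym pE) (etrans _ qE); rewrite (addrC (h *: v) (h *: u)).
  exact: (congr1 (+%R^~ (f x)) (addrAC _ _ _)).
rewrite pq in pe; rewrite distrC in qe.
rewrite -(subrKA ('D_u ('D_v f) q)).
apply: (le_trans (ler_normD _ _)).
by rewrite [leRHS](splitr e); exact: lerD (ltW qe) (ltW pe).
Qed.

(** * Derivative of a determinant *)

Section determinant.
Context (R : realType) (V : normedModType R) (U : set V).
Hypothesis openU : open U.

Lemma derive_smooth_prod (I : finType) (f : I -> V -> R) (x v : V) :
  (forall i, smooth U (f i)) -> U x ->
  'D_v (fun y => \prod_i f i y) x =
  \sum_i 'D_v (f i) x * \prod_(j | j != i) f j x.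
Proof.
(* Induction on the list of indices; its uniqueness ensures that [j != i] removes exactly one
   factor. *)
move=> sf Ux; have := index_enum_uniq I.
elim: (index_enum I) => [_|i r IH /= /andP[ir ur]].
  rewrite big_nil (_ : (fun _ => _) = fun=> 1) ?derive_cst //.
  by apply/funext => y; rewrite big_nil.
have -> : (fun y => \prod_(j <- i :: r) f j y) = fun y => f i y * \prod_(j <- r) f j y.
  by apply/funext => y; rewrite big_cons.
rewrite (derive_smoothM _ (sf i) _ Ux); last exact: (smooth_prod openU).
rewrite IH // big_cons big_cons eqxx /=; congr (_ * _ + _).
  rewrite [RHS]big_seq_cond [LHS]big_seq; apply: eq_bigl => j.
  by case: eqP => [->|]; rewrite ?(negbTE ir) ?andbT.
rewrite big_distrr /= big_seq [RHS]big_seq; apply: eq_bigr => j jr.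
rewrite big_cons; case: eqP => [ij|_]; first by rewrite ij jr in ir.
by rewrite mulrCA.
Qed.

(** Jacobi's formula. The derivative is the sum of the determinants of [B i], in which row [i] alone
    is differentiated; Laplace expansion along that row involves only cofactors of [A x]. *)
Lemma derive_determinant (n : nat) (A : V -> 'M[R]_n) (x v : V) :
  (forall i j, smooth U (fun y => A y i j)) -> U x ->
  'D_v (fun y => \det (A y)) x =
  \sum_i \sum_j 'D_v (fun y => A y i j) x * (\adj (A x)) j i.
Proof.
move=> sA Ux.
pose B i := \matrix_(k, j) if k == i then 'D_v (fun y => A y k j) x else A x k j.
transitivity (\sum_i \det (B i)).
  rewrite /determinant (derive_smooth_sum openU) // => [|s]; last first.
    by apply: (smoothM openU); [exact: smooth_cst|exact: smooth_prod].
  rewrite exchange_big; apply: eq_bigr => s _.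
  rewrite (derive_smoothM (U := U)) ?derive_cst ?mul0r ?add0r //; last 2 first.
  - exact: smooth_cst.
  - exact: (smooth_prod openU).
  rewrite derive_smooth_prod // big_distrr /=; apply: eq_bigr => i _.
  congr (_ * _); rewrite [RHS](bigD1 i) //= mxE eqxx; congr (_ * _).
  by apply: eq_bigr => j /negbTE ji; rewrite mxE ji.
apply: eq_bigr => i _; rewrite (expand_det_row _ i); apply: eq_bigr => j _.
rewrite !mxE eqxx; congr (_ * (_ * \det _)).
by apply/matrixP => k m; rewrite !mxE eq_sym (negbTE (neq_lift _ _)).
Qed.

End determinant.

(** * Homogeneous functions on the slit tangent space *)

Lemma near_line (R : realType) (V : normedModType R) (U : set V) (x v : V) :
  open U -> U x -> \forall h \near (0 : R), U (h *: v + x).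
Proof.
move=> openU Ux.
have c : {for (0 : R), continuous (fun h : R => h *: v + x)}.
  by apply: continuousD; [exact: scalel_continuous|exact: cst_continuous].
apply: c; rewrite scale0r add0r; exact: open_near.
Qed.

Lemma derive_scale (R : realType) (V : normedModType R) (f : V -> R) (x v : V)
    (c : R) :
  differentiable f x -> 'D_(c *: v) f x = c * 'D_v f x.
Proof. by move=> df; rewrite !deriveE // linearZ. Qed.

Section slit_space.
Context (R : realType) (n : nat) (Omega : set 'rV[R]_n).
Hypothesis openOmega : open Omega.

(** [Omega] stands for the image of a chart; [coord_set_slit] then identifies this set with the slit
    tangent bundle in coordinates. *)
Definition slit_set : set ('rV[R]_n * 'rV[R]_n) :=
  [set z | Omega z.1 /\ z.2 != 0].

Lemma open_slit_set : open slit_set.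
Proof.
have -> : slit_set = fst @^-1` Omega `&` snd @^-1` [set v | v != 0].
  by apply/seteqP; split => -[].
apply: openI.
  by apply: open_comp openOmega => z _; exact: cvg_fst.
apply: open_comp => [z _|]; first exact: cvg_snd.
rewrite (_ : [set v | v != 0] = ~` [set 0]); last first.
  by apply/seteqP; split => v /eqP.
apply: closed_openC; apply: (accessible_closed_set1 (hausdorff_accessible (@norm_hausdorff _ _))).
Qed.

Local Notation U := slit_set.

(** Packaging the coordinate as a continuous linear map yields both its smoothness and its
    derivative. *)
Lemma linear_velocity_coord (m : 'I_n) :
  exists2 f : {linear ('rV[R]_n * 'rV[R]_n)%type -> R},
    continuous f & f = (fun z => z.2 0 m) :> (_ -> _).
Proof.
have lin : linear (fun z : 'rV[R]_n * 'rV[R]_n => z.2 0 m).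
  by move=> c z w; rewrite /= !mxE.
pose linM := GRing.isLinear.Build _ _ _ _ _ lin.
pose f : {linear ('rV[R]_n * 'rV[R]_n)%type -> R} :=
  HB.pack (fun z : 'rV[R]_n * 'rV[R]_n => z.2 0 m) linM.
exists f => // z.
apply: (@continuous_comp _ _ _ snd (fun v : 'rV[R]_n => v 0 m)).
  exact: cvg_snd.
exact: coord_continuous.
Qed.

Lemma smooth_velocity_coord (m : 'I_n) :
  smooth U (fun z : 'rV[R]_n * 'rV[R]_n => z.2 0 m).
Proof.
by have [f cf <-] := linear_velocity_coord m; exact: smooth_linear open_slit_set _ cf.
Qed.

Lemma derive_velocity_coord (m : 'I_n) (z w : 'rV[R]_n * 'rV[R]_n) :
  'D_w (fun z : 'rV[R]_n * 'rV[R]_n => z.2 0 m) z = w.2 0 m.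
Proof.
have [f cf fE] := linear_velocity_coord m.
rewrite -fE deriveE; last exact: linear_differentiable.
by rewrite diff_lin // fE.
Qed.

Lemma derive_velocity (f : 'rV[R]_n * 'rV[R]_n -> R) (z : 'rV[R]_n * 'rV[R]_n)
    (v : 'rV[R]_n) :
  differentiable f z ->
  'D_(0, v) f z = \sum_q v 0 q * velocity_derive q f z.
Proof.
move=> df; rewrite deriveE //.
have -> : (0, v) = \sum_q v 0 q *: ((0, delta_mx 0 q) : 'rV[R]_n * 'rV[R]_n).
  rewrite [v in LHS]row_sum_delta.
  elim/big_rec2: _ => // i y1 y2 _ <-.
  by congr pair; rewrite /= ?scaler0 ?add0r.
rewrite linear_sum /=; apply: eq_bigr => q _.
by rewrite linearZ /= /velocity_derive deriveE.
Qed.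

(** Fibre scaling by [c] maps the line through [z] along [w] to the line through [cz] along
    [c *: w]. The derivative of [f] on the latter is [c * 'D_w f cz] by linearity and
    [c ^+ k.+1 * 'D_w f z] by homogeneity; a factor [c] cancels. *)
Lemma velocity_derive_homogeneous (f : 'rV[R]_n * 'rV[R]_n -> R) (k : nat) (a : 'I_n) :
  smooth U f ->
  (forall z (c : R), U z -> 0 < c -> f (z.1, c *: z.2) = c ^+ k.+1 * f z) ->
  forall z (c : R), U z -> 0 < c ->
  velocity_derive a f (z.1, c *: z.2) = c ^+ k * velocity_derive a f z.
Proof.
move=> sf homf z c Uz c0.
pose w : 'rV[R]_n * 'rV[R]_n := (0, delta_mx 0 a).
pose cz : 'rV[R]_n * 'rV[R]_n := (z.1, c *: z.2).
have Ucz : U cz.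
  by case: Uz => Oz z0; split=> //=; rewrite scaler_eq0 negb_or gt_eqF.
have d1 : is_derive (0 : R) 1 (fun h => f (h *: w + z)) ('D_w f z).
  rewrite -[X in 'D_w f X]add0r -[X in 'D_w f (X + _)](scale0r w).
  apply: is_derive_line; apply: smooth_differentiable sf _.
  by rewrite scale0r add0r.
have d2 : is_derive (0 : R) 1 (fun h => f (h *: (c *: w) + cz)) ('D_(c *: w) f cz).
  rewrite -[X in 'D_(c *: w) f X]add0r -[X in 'D_(c *: w) f (X + _)](scale0r (c *: w)).
  apply: is_derive_line; apply: smooth_differentiable sf _.
  by rewrite scale0r add0r.
have d3 : is_derive (0 : R) 1 (fun h => f (h *: (c *: w) + cz)) (c ^+ k.+1 * 'D_w f z).
  apply: near_eq_is_derive (is_deriveZ (c ^+ k.+1) d1).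
  have := near_line w open_slit_set Uz; apply: filterS => h Uh.
  rewrite -[LHS](homf _ _ Uh c0); congr f.
  by rewrite /cz /=; congr pair; rewrite /= ?scaler0 ?scalerDr // !scalerA mulrC.
have : 'D_(c *: w) f cz = c ^+ k.+1 * 'D_w f z.
  by rewrite -(@derive_val _ _ _ _ _ _ _ d2) -(@derive_val _ _ _ _ _ _ _ d3).
rewrite derive_scale; last exact: smooth_differentiable sf Ucz.
by rewrite exprS -mulrA => /(mulfI (lt0r_neq0 c0)).
Qed.

(** Both sides are the derivative at [h = 0] of [f] with the velocity scaled by [1 + h], by the
    chain rule and by homogeneity respectively; the latter applies while [1 + h] is positive. *)
Lemma euler_identity (f : 'rV[R]_n * 'rV[R]_n -> R) :
  smooth U f ->
  (forall z (c : R), U z -> 0 < c -> f (z.1, c *: z.2) = c ^+ 2 * f z) ->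
  forall z, U z -> \sum_q z.2 0 q * velocity_derive q f z = 2 * f z.
Proof.
move=> sf homf z Uz.
rewrite -derive_velocity; last exact: smooth_differentiable sf Uz.
set w : 'rV[R]_n * 'rV[R]_n := (0, z.2).
have d1 : is_derive (0 : R) 1 (fun h => f (h *: w + z)) ('D_w f z).
  rewrite -[X in 'D_w f X]add0r -[X in 'D_w f (X + _)](scale0r w).
  apply: is_derive_line; apply: smooth_differentiable sf _.
  by rewrite scale0r add0r.
have d2 : is_derive (0 : R) 1 (fun h => f z * (1 + h) ^+ 2) (2 * f z).
  have d : is_derive (0 : R) 1 (fun h : R => 1 + h) 1.
    by apply: is_derive_eq (is_deriveD (is_derive_cst _ _ _) (is_derive_id _ _)) _; rewrite add0r.
  apply: is_derive_eq (is_deriveZ (f z) (is_deriveX 2 d)) _.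
  by rewrite /= addr0 expr1 mulr1 -![_ *: _]/(_ * _) mulr1 mulrC.
have d3 : is_derive (0 : R) 1 (fun h => f (h *: w + z)) (2 * f z).
  apply: near_eq_is_derive d2.
  have : \forall h \near (0 : R), -1 < h.
    by apply: lt_nbhsr; rewrite oppr_lt0.
  apply: filterS => h h1.
  rewrite mulrC -homf //; last by rewrite -ltrBlDl sub0r.
  congr f; rewrite /w; case: (z) => x y /=; congr pair => /=.
    by rewrite scaler0 add0r.
  by rewrite scalerDl scale1r addrC.
by rewrite -(@derive_val _ _ _ _ _ _ _ d1) -(@derive_val _ _ _ _ _ _ _ d3).
Qed.

(** Degree 0 makes a maximum on the sphere [S] a maximum on the whole punctured fibre, so the
    derivative vanishes in every direction. The norm is the maximum norm and [S] the surface of a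
    cube; what matters is that it is compact and meets every ray. *)
Lemma exists_critical_velocity (f : 'rV[R]_n * 'rV[R]_n -> R) (u : 'rV[R]_n) :
  (0 < n)%N -> smooth U f -> Omega u ->
  (forall z (c : R), U z -> 0 < c -> f (z.1, c *: z.2) = f z) ->
  exists2 v : 'rV[R]_n, v != 0 & forall a, velocity_derive a f (u, v) = 0.
Proof.
move=> n0 sf Ou homf.
have Uuv v : v != 0 -> U (u, v) by [].
pose S : set 'rV[R]_n := [set v | `|v| = 1].
have S0 v : S v -> v != 0 by move=> Sv; rewrite -normr_eq0 Sv oner_eq0.
have Sn v : v != 0 -> S (`|v|^-1 *: v).
  by move=> v0; rewrite /S /= normrZ normfV normr_id mulVf // normr_eq0.
have cS : compact S.
  apply: bounded_closed_compact.
    by exists 1; split; [exact: num_real|move=> M M1 v /= ->; exact: ltW].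
  have -> : S = (fun v => `|v|) @^-1` [set 1] by [].
  by apply: closed_comp => [v _|]; [exact: norm_continuous|exact: closed_eq].
have neS : S !=set0.
  pose e : 'rV[R]_n := const_mx 1; exists (`|e|^-1 *: e); apply: Sn.
  apply/eqP => /matrixP/(_ 0 (Ordinal n0)); rewrite !mxE => /eqP.
  by rewrite oner_eq0.
have cf : {within S, continuous (fun v => f (u, v))}.
  apply: continuous_in_subspaceT => v; rewrite inE => Sv.
  have cfv := differentiable_continuous (smooth_differentiable sf (Uuv v (S0 v Sv))).
  have cp : {for v, continuous (fun v : 'rV[R]_n => (u, v))}.
    apply: differentiable_continuous.
    by apply: (@differentiable_pair _ _ _ _ (cst u) id); [exact: differentiable_cst|].
  exact: (continuous_comp cp cfv).
have [v vS vmax] := EVT_max_rV neS cS cf.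
rewrite inE in vS; exists v => [|a]; first exact: S0.
have gmax t : t != 0 -> f (u, t) <= f (u, v).
  move=> t0; have := vmax (`|t|^-1 *: t); rewrite inE => /(_ (Sn t t0)).
  by rewrite (homf (u, t)) // ?invr_gt0 ?normr_gt0 //; split.
pose w : 'rV[R]_n * 'rV[R]_n := (0, delta_mx 0 a).
have Uv := Uuv v (S0 v vS).
have /nbhs_ballP[r /= r0 rU] := near_line w open_slit_set Uv.
have Ut t : t \in `]-r, r[ -> U (t *: w + (u, v)).
  rewrite in_itv /= => tr; apply: rU.
  by rewrite -ball_normE /= sub0r normrN ltr_norml.
have dt t : t \in `]-r, r[ ->
    is_derive t 1 (fun h => f (h *: w + (u, v))) ('D_w f (t *: w + (u, v))).
  by move=> tr; apply: is_derive_line; exact: smooth_differentiable sf (Ut t tr).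
have r00 : 0 \in `]-r, r[ by rewrite in_itv /= oppr_lt0 r0.
(* For [t] in []-r, r[] the line stays in the punctured fibre over [u], so [gmax] makes [0] an
   interior maximum. *)
have d0 : is_derive (0 : R) 1 (fun h => f (h *: w + (u, v))) 0.
  apply: (@derive1_at_max _ _ (-r) r) => // [|t tr|t tr].
  - by rewrite ge0_cp // ltW.
  - by case: (dt t tr).
  rewrite scale0r add0r.
  have [_ tv0] := Ut t tr.
  have -> : t *: w + (u, v) = (u, (t *: w + (u, v)).2).
    by congr pair; rewrite /= scaler0 add0r.
  exact: gmax.
have := dt 0 r00; rewrite scale0r add0r => d1.
by rewrite -(@derive_val _ _ _ _ _ _ _ d0) -[LHS](@derive_val _ _ _ _ _ _ _ d1).
Qed.

End slit_space.

(** * Berwald Lagrangians in a chart *)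

Lemma sum_mul_delta (R : realType) (n : nat) (d : R) (F : 'I_n -> 'I_n -> R) :
  \sum_b \sum_a F a b * (d * (b == a)%:R) = (\sum_b F b b) * d.
Proof.
rewrite big_distrl /=; apply: eq_bigr => b _.
rewrite (bigD1 b) //= eqxx mulr1 big1 ?addr0 // => a ab.
by rewrite eq_sym (negbTE ab) !mulr0.
Qed.

(** Meant for the two orders of a second derivative of the determinant [d]: [q] and [q'] are the
    Hessian terms, [r] and [s] the traces of the connection, [x] and [y] their derivatives. *)
Lemma cancel_common (R : realType) (q q' x y r s d : R) : d != 0 -> q = q' ->
  q + 2 * x * d + 2 * r * (2 * s * d) = q' + 2 * y * d + 2 * s * (2 * r * d) ->
  x = y.
Proof. by move=> d0 <- E; apply: (mulIf d0); lra. Qed.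

Section berwald_chart.
Context (R : realType) (n : nat) (Omega : set 'rV[R]_n).
Hypothesis openOmega : open Omega.
Local Notation U := (slit_set Omega).
Local Notation T := ('rV[R]_n * 'rV[R]_n)%type.
Implicit Types (f g : T -> R) (z : T) (a b : 'I_n).

Let openU : open U := open_slit_set openOmega.

(** * Calculus rules for position and velocity derivatives *)

Lemma smooth_position_derive a f : smooth U f -> smooth U (position_derive a f).
Proof. exact: smooth_derive. Qed.

Lemma smooth_velocity_derive a f : smooth U f -> smooth U (velocity_derive a f).
Proof. exact: smooth_derive. Qed.

Lemma velocity_deriveC a b f z : smooth U f -> U z ->
  velocity_derive a (velocity_derive b f) z =
  velocity_derive b (velocity_derive a f) z.
Proof. by move=> sf Uz; exact: derive_comm openU sf Uz. Qed.

Lemma position_deriveC a b f z : smooth U f -> U z ->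
  position_derive a (position_derive b f) z =
  position_derive b (position_derive a f) z.
Proof. by move=> sf Uz; exact: derive_comm openU sf Uz. Qed.

Lemma position_velocity_deriveC a b f z : smooth U f -> U z ->
  position_derive a (velocity_derive b f) z =
  velocity_derive b (position_derive a f) z.
Proof. by move=> sf Uz; exact: derive_comm openU sf Uz. Qed.

Lemma position_deriveM a f g z : smooth U f -> smooth U g -> U z ->
  position_derive a (fun z => f z * g z) z =
  position_derive a f z * g z + f z * position_derive a g z.
Proof. by move=> sf sg Uz; exact: derive_smoothM sf sg Uz. Qed.

Lemma velocity_deriveM a f g z : smooth U f -> smooth U g -> U z ->
  velocity_derive a (fun z => f z * g z) z =
  velocity_derive a f z * g z + f z * velocity_derive a g z.
Proof. by move=> sf sg Uz; exact: derive_smoothM sf sg Uz. Qed.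

Lemma position_deriveZ a (c : R) f z : smooth U f -> U z ->
  position_derive a (fun z => c * f z) z = c * position_derive a f z.
Proof.
move=> sf Uz; rewrite (position_deriveM _ (smooth_cst openU c) sf Uz).
by rewrite /position_derive derive_cst mul0r add0r.
Qed.

Lemma velocity_deriveZ a (c : R) f z : smooth U f -> U z ->
  velocity_derive a (fun z => c * f z) z = c * velocity_derive a f z.
Proof.
move=> sf Uz; rewrite (velocity_deriveM _ (smooth_cst openU c) sf Uz).
by rewrite /velocity_derive derive_cst mul0r add0r.
Qed.

Lemma position_deriveD a f g z : smooth U f -> smooth U g -> U z ->
  position_derive a (fun z => f z + g z) z =
  position_derive a f z + position_derive a g z.
Proof. by move=> sf sg Uz; exact: derive_smoothD sf sg Uz. Qed.

Lemma velocity_deriveD a f g z : smooth U f -> smooth U g -> U z ->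
  velocity_derive a (fun z => f z + g z) z =
  velocity_derive a f z + velocity_derive a g z.
Proof. by move=> sf sg Uz; exact: derive_smoothD sf sg Uz. Qed.

Lemma position_derive_sum a (F : 'I_n -> T -> R) z :
  (forall i, smooth U (F i)) -> U z ->
  position_derive a (fun z => \sum_i F i z) z = \sum_i position_derive a (F i) z.
Proof. by move=> sF Uz; exact: derive_smooth_sum openU _ _ _ _ sF Uz. Qed.

Lemma velocity_derive_sum a (F : 'I_n -> T -> R) z :
  (forall i, smooth U (F i)) -> U z ->
  velocity_derive a (fun z => \sum_i F i z) z = \sum_i velocity_derive a (F i) z.
Proof. by move=> sF Uz; exact: derive_smooth_sum openU _ _ _ _ sF Uz. Qed.

Lemma eq_position_derive a f g z : (forall w, U w -> f w = g w) -> U z ->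
  position_derive a f z = position_derive a g z.
Proof. exact: derive_eq_on. Qed.

Lemma eq_velocity_derive a f g z : (forall w, U w -> f w = g w) -> U z ->
  velocity_derive a f z = velocity_derive a g z.
Proof. exact: derive_eq_on. Qed.

Lemma velocity_derive_fst a (h : 'rV[R]_n -> R) z :
  velocity_derive a (fun w => h w.1) z = 0.
(* By conversion the difference quotient is that of [h] at [z.1] in the zero direction, which
   settles the case of an arbitrary [h]. *)
Proof. exact: (derive0 h z.1). Qed.

Lemma position_derive_velocity_coord a q z :
  position_derive a (fun w => w.2 0 q) z = 0.
Proof. by rewrite /position_derive derive_velocity_coord mxE. Qed.

Lemma velocity_derive_velocity_coord a q z :
  velocity_derive a (fun w => w.2 0 q) z = (q == a)%:R.
Proof. by rewrite /velocity_derive derive_velocity_coord mxE eqxx. Qed.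

(** * The spray and the horizontal derivatives of the Lagrangian and the metric *)

Context (l : T -> R) (Gamma : 'rV[R]_n -> 'I_n -> 'I_n -> 'I_n -> R).
Hypothesis smooth_l : smooth U l.
Hypothesis homogeneous_l : forall z (c : R), U z -> 0 < c ->
  l (z.1, c *: z.2) = c ^+ 2 * l z.
Hypothesis nondegenerate_l : forall z, U z -> lagrange_metric l z \in unitmx.
Hypothesis Gamma_spray : forall z a b d, U z ->
  Gamma z.1 a b d = velocity_derive b (velocity_derive d (spray l a)) z.

Let sv := smooth_velocity_derive.
Let sp := smooth_position_derive.
Let sc := smooth_velocity_coord openOmega.

Lemma smooth_lagrange_metric a b : smooth U (fun z => lagrange_metric l z a b).
Proof.
apply: (smooth_ext openU) (smoothM openU (smooth_cst openU 2^-1) (sv a (sv b smooth_l))).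
by move=> z _; rewrite mxE.
Qed.

Lemma smooth_spray a : smooth U (spray l a).
Proof.
apply: (smoothM openU); first exact: smooth_cst.
apply: (smooth_sum openU) => q _; apply: (smoothM openU).
  apply: (smooth_invmx openU); [exact: smooth_lagrange_metric|exact: nondegenerate_l].
apply: (smoothB openU); last exact: sp.
by apply: (smooth_sum openU) => m _; apply: (smoothM openU); [exact: (sc m)|exact/sp/sv].
Qed.

Local Notation G := (spray l).
(** [N] is the nonlinear connection. [C] is the affine connection kept as a function on the slit
    bundle, where it inherits smoothness from the spray. *)
Let N a q := velocity_derive q (G a).
Let C a b q := velocity_derive b (velocity_derive q (G a)).
Let sG := smooth_spray.
Let sN a q : smooth U (N a q). Proof. exact: sv. Qed.
Let sC a b q : smooth U (C a b q). Proof. exact/sv/sv. Qed.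

(** The Berwald condition enters here: by [Gamma_spray], [C] factors through the base point. *)
Lemma velocity_derive_connection c a b q z : U z -> velocity_derive c (C a b q) z = 0.
Proof.
move=> Uz; rewrite -[RHS](velocity_derive_fst c (fun u => Gamma u a b q) z).
by apply: eq_velocity_derive Uz => w Uw; rewrite Gamma_spray.
Qed.

Lemma euler_position_derive m z : U z ->
  \sum_q z.2 0 q * position_derive m (velocity_derive q l) z =
  2 * position_derive m l z.
Proof.
move=> Uz; rewrite -position_deriveZ //.
rewrite -(eq_position_derive m (euler_identity smooth_l homogeneous_l) Uz).
rewrite position_derive_sum // => [|q]; last by apply: (smoothM openU); [exact: (sc q)|exact: sv].
apply: eq_bigr => q _; rewrite position_deriveM //; last exact: sv.
by rewrite position_derive_velocity_coord mul0r add0r.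
Qed.

(** Euler's identity differentiated in xdot^a: the derivative of the explicit velocity accounts for
    one of the two copies of the right-hand side. *)
Lemma euler_velocity_derive a z : U z ->
  \sum_q z.2 0 q * velocity_derive a (velocity_derive q l) z =
  velocity_derive a l z.
Proof.
move=> Uz; have := velocity_deriveZ a 2 smooth_l Uz.
rewrite -(eq_velocity_derive a (euler_identity smooth_l homogeneous_l) Uz).
rewrite velocity_derive_sum // => [|q]; last by apply: (smoothM openU); [exact: (sc q)|exact: sv].
rewrite (eq_bigr (fun q => (q == a)%:R * velocity_derive q l z +
    z.2 0 q * velocity_derive a (velocity_derive q l) z)) => [|q _]; last first.
  rewrite velocity_deriveM //; last exact: sv.
  by rewrite velocity_derive_velocity_coord.
rewrite big_split /= (bigD1 a) //= eqxx mul1r big1 ?addr0 => [|q /negbTE ->]; last first.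
  by rewrite mul0r.
by rewrite mulr_natl mulr2n => /addrI.
Qed.

(** The definition of the spray multiplied by the metric; [4] times the [2^-1] in [lagrange_metric]
    gives the factor [2]. *)
Lemma spray_equation q z : U z ->
  \sum_m z.2 0 m * position_derive m (velocity_derive q l) z - position_derive q l z =
  2 * \sum_a velocity_derive q (velocity_derive a l) z * G a z.
Proof.
move=> Uz; have ug := nondegenerate_l Uz.
pose s : 'cV[R]_n := \col_q (\sum_m z.2 0 m * position_derive m (velocity_derive q l) z
  - position_derive q l z).
have GE : \col_a G a z = 4^-1 *: (invmx (lagrange_metric l z) *m s).
  apply/colP => a; rewrite !mxE; congr (_ * _).
  by apply: eq_bigr => k _; rewrite !mxE.
have /colP/(_ q) : s = 4 *: (lagrange_metric l z *m \col_a G a z).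
  by rewrite GE -scalemxAr scalerA mulfV ?pnatr_eq0 // scale1r mulKVmx.
rewrite !mxE => ->; rewrite !big_distrr /=; apply: eq_bigr => a _.
by rewrite !mxE; field.
Qed.

(** Constancy of [l] along the spray. Contracting [spray_equation] with xdot^q, the Euler identities
    turn its left side into two copies minus one of the sum and collapse the Hessian on its
    right. *)
Lemma spray_derive z : U z ->
  \sum_m z.2 0 m * position_derive m l z = 2 * \sum_a G a z * velocity_derive a l z.
Proof.
move=> Uz.
have : \sum_q z.2 0 q * (\sum_m z.2 0 m * position_derive m (velocity_derive q l) z
     - position_derive q l z) =
   \sum_q z.2 0 q * (2 * \sum_a velocity_derive q (velocity_derive a l) z * G a z).
  by apply: eq_bigr => q _; rewrite spray_equation.
under eq_bigr do rewrite mulrBr big_distrr /=.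
rewrite sumrB exchange_big /=.
rewrite (eq_bigr (fun m => 2 * (z.2 0 m * position_derive m l z))); last first.
  move=> m _; rewrite mulrCA -euler_position_derive // big_distrr /=.
  by apply: eq_bigr => q _; rewrite mulrCA.
have double_sub (x y : R) : 2 * x - x = y -> x = y by move=> <-; ring.
rewrite -[X in X - _ = _ -> _]mulr_sumr => E.
apply: etrans (double_sub _ _ E) _.
rewrite big_distrr /=.
under eq_bigr do rewrite mulrCA big_distrr /=.
rewrite -big_distrr /= exchange_big /= -big_distrr /=; congr (_ * _).
apply: eq_bigr => a _; rewrite -euler_velocity_derive // mulrC big_distrl /=.
by apply: eq_bigr => q _; rewrite mulrA (velocity_deriveC q a).
Qed.

(** Horizontal constancy of [l]. The xdot^q-derivative of [spray_derive] reads [x + s = 2 * (t + h)]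
    and [spray_equation] reads [s - x = 2 * h]; subtracting leaves [x = t]. *)
Lemma position_derive_lagrangian q z : U z ->
  position_derive q l z = \sum_a N a q z * velocity_derive a l z.
Proof.
move=> Uz.
have sl m : smooth U (fun w => w.2 0 m * position_derive m l w).
  by apply: (smoothM openU); [exact: (sc m)|exact: sp].
have sr a : smooth U (fun w => G a w * velocity_derive a l w).
  by apply: (smoothM openU); [exact: sG|exact: sv].
have lhs : velocity_derive q (fun w => \sum_m w.2 0 m * position_derive m l w) z =
    position_derive q l z +
    \sum_m z.2 0 m * position_derive m (velocity_derive q l) z.
  rewrite (velocity_derive_sum q sl Uz).
  rewrite (eq_bigr (fun m => (m == q)%:R * position_derive m l z +
      z.2 0 m * position_derive m (velocity_derive q l) z)) => [|m _]; last first.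
    rewrite (velocity_deriveM q (sc m) (sp m smooth_l) Uz).
    by rewrite velocity_derive_velocity_coord position_velocity_deriveC.
  rewrite big_split /=; congr (_ + _).
  by rewrite (bigD1 q) //= eqxx mul1r big1 ?addr0 // => m /negbTE ->; rewrite mul0r.
have rhs : velocity_derive q (fun w => 2 * \sum_a G a w * velocity_derive a l w) z =
    2 * (\sum_a N a q z * velocity_derive a l z +
         \sum_a velocity_derive q (velocity_derive a l) z * G a z).
  have srs : smooth U (fun w => \sum_a G a w * velocity_derive a l w).
    exact: (smooth_sum openU).
  rewrite (velocity_deriveZ q 2 srs Uz).
  rewrite (velocity_derive_sum q sr Uz) -big_split /=; congr (_ * _).
  apply: eq_bigr => a _; rewrite (velocity_deriveM q (sG a) (sv a smooth_l) Uz).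
  by congr (_ + _); rewrite mulrC.
have solve (x s t h : R) : x + s = 2 * (t + h) -> s - x = 2 * h -> x = t.
  by move=> *; lra.
apply: solve (spray_equation q Uz).
rewrite -lhs -rhs; exact (eq_velocity_derive q spray_derive Uz).
Qed.

(** Metric compatibility of the connection, from two velocity derivatives of
    [position_derive_lagrangian]. The term differentiating [C] vanishes, those with [C]
    undifferentiated are the connection terms, and the third derivatives of [l] give the term in
    [N]. *)
Lemma position_derive_metric q c b z : U z ->
  position_derive q (fun w => lagrange_metric l w c b) z =
  \sum_a N a q z * velocity_derive a (fun w => lagrange_metric l w c b) z +
  \sum_a C a b q z * lagrange_metric l z c a +
  \sum_a C a c q z * lagrange_metric l z a b.
Proof.
move=> Uz.
have gE c' b' : (fun w => lagrange_metric l w c' b') =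
    (fun w => 2^-1 * velocity_derive c' (velocity_derive b' l) w).
  by apply/funext => w; rewrite mxE.
have sl2 c' b' : smooth U (velocity_derive c' (velocity_derive b' l)) by exact/sv/sv.
rewrite gE position_deriveZ //.
rewrite position_velocity_deriveC //; last exact: sv.
rewrite (eq_velocity_derive c (g := fun w => \sum_a
    (C a b q w * velocity_derive a l w +
     N a q w * velocity_derive b (velocity_derive a l) w))) //; last first.
  move=> w Uw; rewrite position_velocity_deriveC //.
  apply: etrans (eq_velocity_derive b (position_derive_lagrangian q) Uw) _.
  have sNl a : smooth U (fun w => N a q w * velocity_derive a l w).
    by apply: (smoothM openU) => //; exact: sv.
  rewrite (velocity_derive_sum b sNl Uw); apply: eq_bigr => a _.
  by rewrite (velocity_deriveM b (sN a q) (sv a smooth_l) Uw).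
have sCl a : smooth U (fun w => C a b q w * velocity_derive a l w).
  by apply: (smoothM openU) => //; exact: sv.
have sNl a : smooth U (fun w => N a q w * velocity_derive b (velocity_derive a l) w).
  exact: (smoothM openU).
rewrite (velocity_derive_sum c (fun a => smoothD openU (sCl a) (sNl a)) Uz).
rewrite big_distrr -!big_split /=; apply: eq_bigr => a _.
rewrite (velocity_deriveD c (sCl a) (sNl a) Uz).
rewrite (velocity_deriveM c (sC a b q) (sv a smooth_l) Uz).
rewrite (velocity_deriveM c (sN a q) (sl2 b a) Uz).
have vvv : velocity_derive c (velocity_derive b (velocity_derive a l)) z =
    velocity_derive a (velocity_derive c (velocity_derive b l)) z.
  rewrite -(velocity_deriveC c a (sv b smooth_l) Uz).
  exact (eq_velocity_derive c (fun w => @velocity_deriveC b a l w smooth_l) Uz).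
rewrite (velocity_deriveZ a _ (sl2 c b) Uz) !mxE.
have collect (h k k' x y p r r' s t t' : R) : k = 0 -> r = r' -> t = t' ->
    h * (k * k' + x * y + (p * r + s * t)) =
    s * (h * t') + x * (h * y) + p * (h * r') by move=> -> -> ->; ring.
exact: collect (velocity_derive_connection c a b q Uz)
  (velocity_deriveC b a smooth_l Uz) vvv.
Qed.

(** * The determinant of the L-metric and the trace of the connection *)

Let D z := \det (lagrange_metric l z).
Let tr q z := \sum_b C b q b z.

Let sD : smooth U D.
Proof. exact: (smooth_determinant openU) smooth_lagrange_metric. Qed.

Let str q : smooth U (tr q).
Proof. exact: (smooth_sum openU). Qed.

(** Jacobi's formula applied to [position_derive_metric]. The metric times its adjugate is [D] times
    the identity, so each of the two connection terms contributes one [tr q z * D z]. *)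
Lemma position_derive_determinant q z : U z ->
  position_derive q D z =
  \sum_a N a q z * velocity_derive a D z + 2 * tr q z * D z.
Proof.
move=> Uz; set g := lagrange_metric l z.
have jacobi w : 'D_w D z =
    \sum_c \sum_b 'D_w (fun y => lagrange_metric l y c b) z * (\adj g) b c.
  exact: (derive_determinant openU) smooth_lagrange_metric Uz.
have trE : \sum_b C b b q z = tr q z.
  by apply: eq_bigr => b _; exact: velocity_deriveC.
have adjE a b : \sum_c (\adj g) b c * g c a = D z * (b == a)%:R.
  have /matrixP/(_ b a) := mul_adj_mx g.
  by rewrite !mxE => ->; rewrite mulr_natr.
have adjE' a c : \sum_b g a b * (\adj g) b c = D z * (a == c)%:R.
  have /matrixP/(_ a c) := mul_mx_adj g.
  by rewrite !mxE => ->; rewrite mulr_natr.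
rewrite {1}/position_derive jacobi.
transitivity (\sum_c \sum_b (
    \sum_a N a q z * (velocity_derive a (fun y => lagrange_metric l y c b) z * (\adj g) b c) +
    \sum_a C a b q z * ((\adj g) b c * g c a) +
    \sum_a C a c q z * (g a b * (\adj g) b c))).
  apply: eq_bigr => c _; apply: eq_bigr => b _.
  apply: etrans (congr1 ( *%R^~ _) (position_derive_metric q c b Uz)) _.
  rewrite !mulrDl !big_distrl /=.
  congr (_ + _ + _); apply: eq_bigr => a _.
  - exact: esym (mulrA _ _ _).
  - exact: etrans (mulrAC _ _ _) (etrans (esym (mulrA _ _ _)) _).
  - exact: esym (mulrA _ _ _).
under eq_bigr do rewrite !big_split /=.
rewrite !big_split /= -addrA; congr (_ + _).
  under eq_bigr do rewrite exchange_big /=.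
  rewrite exchange_big /=; apply: eq_bigr => a _.
  rewrite [velocity_derive a D z]jacobi big_distrr /=; apply: eq_bigr => c _.
  by rewrite big_distrr.
rewrite -mulrA mulr_natl mulr2n -trE; congr (_ + _).
  rewrite exchange_big /= -(sum_mul_delta _ (fun a b => C a b q z)); apply: eq_bigr => b _.
  rewrite exchange_big /=; apply: eq_bigr => a _.
  by rewrite -big_distrr /= adjE.
rewrite -(sum_mul_delta _ (fun a b => C a b q z)); apply: eq_bigr => c _.
rewrite exchange_big /=; apply: eq_bigr => a _.
by rewrite -big_distrr /= adjE' eq_sym.
Qed.

(** [position_derive_determinant] is differentiated once more. Criticality removes the terms with a
    first velocity derivative of [D]. The mixed derivative of [D] that remains is commuted and read
    off the same identity differentiated in velocity, where [tr] contributes nothing, depending on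
    position only. *)
Lemma position_derive2_determinant a b z : U z ->
  (forall k, velocity_derive k D z = 0) ->
  position_derive b (position_derive a D) z =
  \sum_k N k a z * (\sum_j N j b z * velocity_derive k (velocity_derive j D) z) +
  2 * position_derive b (tr a) z * D z + 2 * tr a z * (2 * tr b z * D z).
Proof.
move=> Uz crit.
have pD c : position_derive c D z = 2 * tr c z * D z.
  rewrite position_derive_determinant // big1 ?add0r // => k _.
  by rewrite crit mulr0.
have sNv c k : smooth U (fun w => N k c w * velocity_derive k D w).
  by apply: (smoothM openU) => //; exact: sv.
have sNs c : smooth U (fun w => \sum_k N k c w * velocity_derive k D w).
  exact: (smooth_sum openU).
have s2 c : smooth U (fun w => 2 * tr c w).
  by apply: (smoothM openU) => //; exact: smooth_cst.
have s2D c : smooth U (fun w => 2 * tr c w * D w) by exact: (smoothM openU).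
have tr0 k c : velocity_derive k (tr c) z = 0.
  apply: etrans (velocity_derive_sum k (fun d => sC d c d) Uz) _.
  apply: big1 => d _.
  exact: velocity_derive_connection.
have vpD k c : velocity_derive k (position_derive c D) z =
    \sum_j N j c z * velocity_derive k (velocity_derive j D) z.
  apply: etrans (eq_velocity_derive k (position_derive_determinant c) Uz) _.
  rewrite (velocity_deriveD k (sNs c) (s2D c) Uz).
  rewrite (velocity_derive_sum k (sNv c) Uz) (velocity_deriveM k (s2 c) sD Uz).
  rewrite (velocity_deriveZ k 2 (str c) Uz) tr0 crit !mulr0 mul0r !addr0.
  apply: eq_bigr => j _; rewrite (velocity_deriveM k (sN j c) (sv j sD) Uz).
  by rewrite crit mulr0 add0r.
apply: etrans (eq_position_derive b (position_derive_determinant a) Uz) _.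
rewrite (position_deriveD b (sNs a) (s2D a) Uz).
rewrite (position_derive_sum b (sNv a) Uz) (position_deriveM b (s2 a) sD Uz).
rewrite (position_deriveZ b 2 (str a) Uz) pD addrA; congr (_ + _ + _).
apply: eq_bigr => k _; rewrite (position_deriveM b (sN k a) (sv k sD) Uz).
have zero_add (x y p q r : R) : y = 0 -> q = r -> x * y + p * q = p * r.
  by move=> -> ->; rewrite mulr0 add0r.
exact: zero_add (crit k) (etrans (position_velocity_deriveC b k sD Uz) (vpD k b)).
Qed.

Lemma determinant_homogeneous z (c : R) : U z -> 0 < c -> D (z.1, c *: z.2) = D z.
Proof.
move=> Uz c0; apply: (congr1 (fun A : 'M[R]_n => \det A)).
apply/matrixP => a b; rewrite [LHS]mxE [RHS]mxE; apply: congr1.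
(* Two velocity derivatives lower the degree from 2 to 1 and then to 0. *)
have homv := @velocity_derive_homogeneous _ _ _ openOmega _ 1 b smooth_l homogeneous_l.
have := @velocity_derive_homogeneous _ _ _ openOmega _ 0 a (sv b smooth_l) homv z c Uz c0.
by rewrite expr0 mul1r.
Qed.

(** One velocity suffices, because [tr] depends on position only. *)
Lemma exists_velocity_trace_closed u a b : Omega u ->
  exists2 v : 'rV[R]_n, v != 0 &
    position_derive b (tr a) (u, v) = position_derive a (tr b) (u, v).
Proof.
(* The index [a] itself shows that the dimension is positive. *)
move=> Ou; have n0 : (0 < n)%N := leq_ltn_trans (leq0n a) (ltn_ord a).
have [v v0 crit] := exists_critical_velocity openOmega n0 sD Ou determinant_homogeneous.
have Uz : U (u, v) by [].
exists v; first exact: v0.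
have D0 : D (u, v) != 0 by have := nondegenerate_l Uz; rewrite unitmxE unitfE.
have eq2 := etrans (esym (position_derive2_determinant b a Uz crit))
  (etrans (position_deriveC a b sD Uz) (position_derive2_determinant a b Uz crit)).
(* The Hessian of [D] is symmetric, so its contraction with [N] is symmetric in [a] and [b]. *)
have sym : \sum_k N k b (u, v) *
      (\sum_j N j a (u, v) * velocity_derive k (velocity_derive j D) (u, v)) =
    \sum_k N k a (u, v) *
      (\sum_j N j b (u, v) * velocity_derive k (velocity_derive j D) (u, v)).
  transitivity (\sum_k \sum_j N k b (u, v) * (N j a (u, v) *
      velocity_derive k (velocity_derive j D) (u, v))).
    by apply: eq_bigr => k _; rewrite big_distrr.
  rewrite exchange_big /=; apply: eq_bigr => k _.
  rewrite big_distrr /=; apply: eq_bigr => j _.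
  apply: etrans (mulrCA _ _ _) _; do 2 apply: congr1.
  exact (velocity_deriveC j k sD Uz).
exact: esym (cancel_common D0 sym eq2).
Qed.

(** Symmetry of the lower indices of [Gamma] settles the first and third sums, and swapping the
    summation indices the fourth. The second is the derivative of the trace, symmetric because the
    trace is closed. *)
Lemma ricci_sym u a b : Omega u -> ricci Gamma b a u = ricci Gamma a b u.
Proof.
move=> Ou; have [v v0 trE] := exists_velocity_trace_closed a b Ou.
have Uz : U (u, v) by split; [exact: Ou|exact: v0].
have Csym m i j w : U w -> C m i j w = C m j i w by exact: velocity_deriveC.
have GammaE m i j : Gamma u m i j = C m i j (u, v) := Gamma_spray m i j Uz.
have DGammaE k m i j : 'D_(delta_mx 0 k) (fun y => Gamma y m i j) u =
    position_derive k (C m i j) (u, v).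
  apply: (@eq_position_derive k (fun w => Gamma w.1 m i j)) Uz => w Uw.
  exact: Gamma_spray.
have Gsym m i j : Gamma u m i j = Gamma u m j i by rewrite !GammaE Csym.
rewrite /ricci; apply: (congr2 (fun p q => p - q)).
  apply: congr2; first apply: (congr2 (fun p q => p - q)).
- apply: eq_bigr => m _; rewrite !DGammaE.
  exact: eq_position_derive (fun w => @Csym m b a w) Uz.
- transitivity (position_derive a (tr b) (u, v)).
    rewrite (position_derive_sum a (fun m => sC m b m) Uz).
    by apply: eq_bigr => m _; exact: DGammaE.
  rewrite -trE (position_derive_sum b (fun m => sC m a m) Uz).
  by apply: eq_bigr => m _; apply: esym; exact: DGammaE.
- by apply: eq_bigr => m _; apply: eq_bigr => s _; rewrite (Gsym s a).
rewrite exchange_big; apply: eq_bigr => m _; apply: eq_bigr => s _ /=.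
exact: mulrC.
Qed.

End berwald_chart.

(** * Finsler spacetimes *)

Section slit_chart.
Context (R : realType) (n : nat) (M : manifold R n) (c : chart R n M).
Hypothesis atlas_c : atlas c.

(** Linear changes of chart send 0 to 0, so a vector vanishes exactly when its component in the
    single chart [c] does. *)
Lemma coord_set_slit :
  coord_set (@slit_tangent_bundle R n M) c = slit_set (chart_img c).
Proof.
apply/seteqP; split => z [Iz Sz]; split=> //.
  apply/eqP => z20; apply: Sz => c' /=.
  by rewrite /component_of_coord z20; case: asboolP => // _; rewrite linear0.
move=> S0; move/eqP: Sz; apply.
by have := of_tangent_coordK atlas_c Iz; case: z {Iz} S0 => x v S0 [_ <-]; exact: S0.
Qed.

Lemma of_tangent_coord_scale (z : 'rV[R]_n * 'rV[R]_n) (k : R) :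
  chart_img c z.1 ->
  of_tangent_coord c (z.1, k *: z.2) = tangent_scale k (of_tangent_coord c z).
Proof.
move=> Iz; have [y cy yz] := Iz.
rewrite -[RHS](tangent_coordK (c := c)); last first.
  by rewrite /= -yz chart_mapK.
congr of_tangent_coord; have := of_tangent_coordK atlas_c Iz.
rewrite /tangent_coord /= => E; rewrite -{1}E; congr pair => /=.
by rewrite -[in LHS]E.
Qed.

End slit_chart.

Theorem theorem2 (R : realType) (n : nat) (M : manifold R n)
    (A : set (tangent_bundle M)) (L : tangent_bundle M -> R)
    (finsler_L : finsler_spacetime A L)
    (berwald_L : berwald A L)
    (A_slit : A = @slit_tangent_bundle R n M)
    (Gamma : chart R n M -> 'rV[R]_n -> 'I_n -> 'I_n -> 'I_n -> R)
    (Gamma_induced : induced_connection A L Gamma)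
    (x : M) (c : chart R n M) (c_at_x : chart_at x c) (a b : 'I_n) :
  ricci (Gamma c) b a (c x) = ricci (Gamma c) a b (c x).
Proof.
have [Ac cx] := c_at_x.
have UE : coord_set A c = slit_set (chart_img c) by rewrite A_slit coord_set_slit.
apply: (@ricci_sym R n (chart_img c) _ (coord_fun L c)); last by exists x.
- exact: chart_img_open.
- by rewrite -UE; exact: finsler_smooth finsler_L _ Ac.
- move=> z k Uz k0; rewrite /coord_fun of_tangent_coord_scale //; last by case: Uz.
  by apply: (finsler_homogeneous finsler_L) => //; rewrite -UE in Uz; case: Uz.
- by move=> z; rewrite -UE; exact: finsler_nondegenerate finsler_L _ _ Ac.
by move=> z i j k; rewrite -UE => Uz; have [_] := Gamma_induced c z Ac Uz; exact.
Qed.
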